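(* The following assertion is false: ''For every integer $k\ge 4$ and every real $\alpha>0$, there exist $\delta>0$ and $n_0\in\mathbb{N}$ such that, if $H$ is a red-blue coloured $k$-graph on $n\ge n_0$ vertices with $\delta_1(H)\ge (d_k+\alpha)\binom{n}{k-1}$, then $H$ contains a tight Hamilton cycle with at least $(1/2+\delta)n$ edges of one colour.'' More precisely, $$d_{17,8}=\frac{5761}{8192}>1-\frac{8}{17}\left(\frac{33}{34}\right)^{15}=d_{17}.$$ Consequently, there exists a fixed $\alpha>0$ such that, for arbitrarily large $n$, there is a red-blue coloured $17$-graph $H$ on $n$ vertices satisfying $$\delta_1(H)\ge (d_{17}+\alpha)\binom{n}{16}$$ such that every tight Hamilton cycle in $H$ has exactly $n/2$ red edges and $n/2$ blue edges.
   Context: A $k$-graph is a hypergraph in which every edge is a set of exactly $k$ vertices. A red-blue coloured $k$-graph is a $k$-graph each of whose edges is coloured red or blue. The minimum vertex degree $\delta_1(H)$ is the minimum, over all vertices $v$ of $H$, of the number of edges containing $v$. A tight Hamilton cycle in an $n$-vertex $k$-graph $H$ is a cyclic ordering $v_1,\ldots,v_n$ of all the vertices of $H$ such that $\{v_i,v_{i+1},\ldots,v_{i+k-1}\}\in E(H)$ for every $i$ (subscripts modulo $n$); its edges are these $n$ sets. For $k\ge 3$, define $$d_k:=1-\frac{k-1}{2k}\left(1-\frac{1}{2k}\right)^{k-2}.$$ For $k\ge 3$ and $a\in\{0,\ldots,k-1\}$, let $X_{k,a}\sim\operatorname{Bin}\left(k-1,\frac{2a+1}{2k}\right)$ be a binomial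 random variable, with $\mathbb{P}(X_{k,a}=j)=0$ for $j\notin\{0,\ldots,k-1\}$, and define $$d_{k,a}:=1-\max\bigl\{\mathbb{P}\bigl(X_{k,a}\in\{a-1,a+2\}\bigr),\ \mathbb{P}\bigl(X_{k,a}\in\{a-2,a+1\}\bigr)\bigr\}.$$ *)

(* Defs.v *)
From mathcomp Require Import all_boot all_order all_algebra.
From mathcomp Require Import classical_sets reals constructive_ereal.
From mathcomp Require Import binomial_distribution.

Set Implicit Arguments.
Unset Strict Implicit.
Unset Printing Implicit Defensive.

Import Order.TTheory GRing.Theory Num.Theory.

Local Open Scope ring_scope.

Definition d_k (R : realType) (k : nat) : R :=
  1 - (k%:R - 1) / (2 * k%:R) * (1 - 1 / (2 * k%:R)) ^+ (k - 2).

(* The law of X_{k,a}. *)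
Definition lawX (R : realType) (k a : nat) : set nat -> \bar R :=
  binomial_prob (k - 1) ((2 * a%:R + 1) / (2 * k%:R)).

(* The values are compared in [int], so that a negative value such as a - 1 for
   a = 0 has probability 0. *)
Definition probX_pair (R : realType) (k a : nat) (x y : int) : R :=
  fine (lawX R k a [set j : nat | j%:Z = x \/ j%:Z = y]%classic).

Definition d_ka (R : realType) (k a : nat) : R :=
  1 - Num.max (probX_pair R k a (a%:Z - 1) (a%:Z + 2))
              (probX_pair R k a (a%:Z - 2) (a%:Z + 1)).

Record coloured_kgraph (k : nat) (V : finType) := ColouredKGraph {
  red_edges : {set {set V}};
  blue_edges : {set {set V}};
  red_blue_disjoint : [disjoint red_edges & blue_edges];
  edges_uniform : forall e, e \in red_edges :|: blue_edges -> #|e| = k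
}.

Definition edges (k : nat) (V : finType) (H : coloured_kgraph k V) :
  {set {set V}} := red_edges H :|: blue_edges H.

Definition degree (k : nat) (V : finType) (H : coloured_kgraph k V) (v : V) :
  nat := #|[set e in edges H | v \in e]|.

(* No degree exceeds #|edges H|, so for nonempty V the default value of the
   iterated minimum does not contribute. *)
Definition min_degree (k : nat) (V : finType) (H : coloured_kgraph k V) :
  nat := \big[minn/#|edges H|]_(v : V) degree H v.

(* [ordS] is the successor modulo #|V|. *)
Definition window (k : nat) (V : finType) (c : 'I_#|V| -> V) (i : 'I_#|V|) :
  {set V} := [set c (iter j (@ordS #|V|) i) | j : 'I_k].

Definition tight_hamilton_cycle (k : nat) (V : finType)
    (H : coloured_kgraph k V) (c : 'I_#|V| -> V) : Prop :=
  bijective c /\ forall i, window k c i \in edges H.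

Definition cycle_edges (k : nat) (V : finType) (c : 'I_#|V| -> V) :
  {set {set V}} := [set window k c i | i : 'I_#|V|].

Definition red_count (k : nat) (V : finType) (H : coloured_kgraph k V)
    (c : 'I_#|V| -> V) : nat := #|cycle_edges k c :&: red_edges H|.

Definition blue_count (k : nat) (V : finType) (H : coloured_kgraph k V)
    (c : 'I_#|V| -> V) : nat := #|cycle_edges k c :&: blue_edges H|.

(* Main.v *)
Require Import Defs.
From mathcomp Require Import classical_sets cardinality fsbigop esum.
From mathcomp Require Import constructive_ereal binomial_distribution.
From mathcomp Require Import all_boot all_order all_algebra.
From mathcomp Require Import reals.
From mathcomp Require Import zify ring lra.

Set Implicit Arguments.
Unset Strict Implicit.
Unset Printing Implicit Defensive.

Import Order.TTheory GRing.Theory Num.Theory.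

(** Fix a set [A] of vertices and take as edges all [k]-sets [e] except those
    with [#|e :&: A|] equal to [a - 1] or [a + 2].  Consecutive windows of a
    tight Hamilton cycle differ by one vertex leaving and one entering, so the
    number of vertices of [A] in a window changes by at most one at each step
    and can never jump over a forbidden value: along the whole cycle it stays
    below [a - 1], or in [{a, a + 1}], or above [a + 2].  On the other hand its
    average over the cycle is [k * #|A| / n], because every vertex lies in
    exactly [k] windows.  If [#|A| = (2a + 1) n / (2k)], this average is
    [a + 1/2], which rules out the two outer ranges and forces exactly half of
    the windows to meet [A] in [a] vertices and the other half in [a + 1]
    ([windowI_trapped], [skip_count_balanced]).  Colouring the edges red when
    they have at most [a] vertices in [A] and blue otherwise thus balances every
    tight Hamilton cycle.

    For [k = 17] and [a = 8] the set [A] is half of the vertices.  A vertex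
    lies in all the possible edges but those whose other 16 vertices meet [A]
    in 7 or 10 (or 6 or 9) elements; as these 16 vertices are asymptotically
    16 fair coin flips, the relative degree of each vertex tends to
    [1 - (C(16,6) + C(16,9)) / 2^16 = d_(17,8)], about 0.7033, whereas [d_17] is
    about 0.6993.  So [alpha = 1/1000] leaves room for the error terms once
    half of the number of vertices is at least [10^5]
    ([half_density_bound]).  The existence of such graphs for arbitrarily many
    vertices ([balanced_17_graphs]) refutes the general assertion at once. *)

(** * Windows of a cyclic ordering *)

Lemma iter_ordS n j (i : 'I_n) : iter j (@ordS n) i = (i + j) %% n :> nat.
Proof.
elim: j => [|j IHj] /=; first by rewrite addn0 modn_small.
by rewrite IHj -addn1 modnDml addn1 addnS.
Qed.

Lemma iter_ordS_inj n (i : 'I_n) (j l : nat) :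
  j < n -> l < n -> iter j (@ordS n) i = iter l (@ordS n) i -> j = l.
Proof.
move=> jn ln /(congr1 (@nat_of_ord n)); rewrite !iter_ordS => /eqP.
by rewrite eqn_modDl !modn_small // => /eqP.
Qed.

(** Iterating [ordS] from any index reaches every index, so a property that is
    preserved by one step around the cycle is constant. *)
Lemma ordS_invariant n (P : 'I_n -> Prop) (i : 'I_n) :
  (forall j, P j -> P (ordS j)) -> P i -> forall j, P j.
Proof.
move=> PS Pi j; have -> : j = iter (n - i + j) (@ordS n) i.
  apply: val_inj; rewrite /= iter_ordS addnA subnKC; last exact: ltnW.
  by rewrite modnDl modn_small.
by elim: (n - i + j) => //= l; exact: PS.
Qed.

Section Windows.
Variables (V : finType) (c : 'I_#|V| -> V).

(** When [k] is smaller than the number of vertices, the [n] positions give [n]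
    different edges, so counting edges of the cycle amounts to counting
    positions.  If two windows agreed, the start of one would lie strictly
    inside the other, and walking on from there would return to the start in
    at most [k] steps. *)
Lemma window_inj k : 0 < k < #|V| -> injective c -> injective (window k c).
Proof.
move=> /andP[k_gt0 ltkn] c_inj i j eq_ij.
have memP x y : c x \in window k c y -> exists2 l, l < k & x = iter l (@ordS _) y.
  by case/imsetP => l _ /c_inj ->; exists l.
have [l ltlk i_def] : exists2 l, l < k & i = iter l (@ordS _) j.
  by apply: memP; rewrite -eq_ij; apply/imsetP; exists (Ordinal k_gt0).
case: l ltlk i_def => // l ltlk i_def; exfalso.
have [r ltrk] : exists2 r, r < k & iter l (@ordS _) j = iter r (@ordS _) i.
  by apply: memP; rewrite eq_ij; apply/imsetP; exists (Ordinal (ltnW ltlk)).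
move=> /(congr1 (@ordS _)); rewrite -iterS -i_def -iterS => i_loop.
have := @iter_ordS_inj _ i 0 r.+1; rewrite -i_loop => /(_ _ _ erefl).
by move=> H; have := H (leq_ltn_trans (leq0n _) ltkn) (leq_ltn_trans ltrk ltkn).
Qed.

Variable A : {set V}.

Lemma card_windowI k i : k <= #|V| -> injective c ->
  #|window k c i :&: A| = \sum_(j < k) (c (iter j (@ordS _) i) \in A).
Proof.
move=> lekn c_inj; rewrite -sum1_card (eq_bigl (fun x => (x \in window k c i) && (x \in A))).
  rewrite big_mkcondr big_imset /=; last first.
    move=> x y _ _ /c_inj /iter_ordS_inj eq_xy; apply/val_inj/eq_xy.
      exact: leq_trans lekn.
    exact: leq_trans lekn.
  by apply: eq_bigr => j _; case: ifP.
by move=> x; rewrite inE.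
Qed.

(** Double counting: for each offset [j], the vertex at distance [j] from the
    start of the window runs through all vertices exactly once. *)
Lemma sum_card_windowI k : k <= #|V| -> bijective c ->
  \sum_i #|window k c i :&: A| = (k * #|A|)%N.
Proof.
move=> lekn c_bij; under eq_bigr do rewrite (card_windowI _ lekn (bij_inj c_bij)).
rewrite exchange_big /= (eq_bigr (fun=> #|A|)).
  by rewrite sum_nat_const card_ord.
move=> j _; rewrite -[RHS]sum1_card [RHS]big_mkcond /=.
have shift_bij : bijective (fun i => c (iter j (@ordS #|V|) i)).
  apply: (bij_comp c_bij); elim: (val j) => [|l] /=; first by exists id.
  exact: bij_comp (ordS_bij _).
by rewrite (reindex _ (onW_bij _ shift_bij)); apply: eq_bigr => i _; case: ifP.
Qed.

(** Both windows are a window of length [k + 1] with one end removed. *)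
Lemma card_windowI_step k i : k <= #|V| -> injective c ->
  (#|window k c (ordS i) :&: A| <= #|window k c i :&: A|.+1) /\
  (#|window k c i :&: A| <= #|window k c (ordS i) :&: A|.+1).
Proof.
move=> lekn c_inj; rewrite !card_windowI //.
have := erefl (\sum_(j < k.+1) (c (iter j (@ordS _) i) \in A)).
rewrite {1}big_ord_recl big_ord_recr /=.
rewrite (eq_bigr (fun j : 'I_k => nat_of_bool (c (iter j (@ordS _) (ordS i)) \in A))).
  by case: (c i \in A); case: (_ \in A); rewrite ?add0n ?addn0 ?add1n ?addn1;
    [case=> -> | move=> <- | move=> -> | move=> ->]; split; rewrite // ltnW // ltnW.
by move=> j _; rewrite /bump /= -iterSr.
Qed.
End Windows.

(** * Hypergraphs that skip two intersection sizes *)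

Section Skip.
Variables (V : finType) (k a : nat) (A : {set V}).

(** The sizes [a - 1] and [a + 2], written so that [a = 0] only skips [2]. *)
Definition skipped (j : nat) : bool := (j.+1 == a) || (j == a.+2).

Definition skip_red : {set {set V}} :=
  [set e : {set V} | [&& #|e| == k, ~~ skipped #|e :&: A| & #|e :&: A| <= a]].

Definition skip_blue : {set {set V}} :=
  [set e : {set V} | [&& #|e| == k, ~~ skipped #|e :&: A| & a < #|e :&: A|]].

Lemma skip_disjoint : [disjoint skip_red & skip_blue].
Proof.
apply/pred0P => e; apply/negP; rewrite /= !inE.
by case/andP => /and3P[_ _ le] /and3P[_ _]; rewrite ltnNge le.
Qed.

Lemma mem_skip_edges e :
  (e \in skip_red :|: skip_blue) = (#|e| == k) && ~~ skipped #|e :&: A|.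
Proof. by rewrite !inE ltnNge; case: (_ <= _); rewrite !(andbF, andbT, orbF). Qed.

Lemma skip_uniform e : e \in skip_red :|: skip_blue -> #|e| = k.
Proof. by rewrite mem_skip_edges => /andP[/eqP]. Qed.

Definition skip_kgraph := ColouredKGraph skip_disjoint skip_uniform.

Hypothesis lt_kn : 0 < k < #|V|.
(* The average of [#|window k c i :&: A|] over the cycle is [a + 1/2]. *)
Hypothesis cardA : 2 * k * #|A| = (2 * a + 1) * #|V|.
Variable (c : 'I_#|V| -> V).
Hypothesis c_tight : tight_hamilton_cycle skip_kgraph c.

Let lekn : k <= #|V|. Proof. by case/andP: lt_kn => _ /ltnW. Qed.
Let c_inj : injective c. Proof. by case: c_tight => /bij_inj. Qed.

(** The three ranges cut out by the skipped sizes are each invariant along the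
    cycle, and the average [a + 1/2] excludes the outer two. *)
Lemma windowI_trapped i : a <= #|window k c i :&: A| <= a.+1.
Proof.
have [c_bij c_edge] := c_tight.
have f_ok j : ~~ skipped #|window k c j :&: A|.
  by have := c_edge j; rewrite mem_skip_edges => /andP[].
have f_step j := card_windowI_step A j lekn c_inj.
have f_sum := sum_card_windowI A lekn c_bij.
apply: contraT; rewrite negb_and -!ltnNge => /orP[lt_fa|lt_af].
  have below : forall j, #|window k c j :&: A|.+1 < a.
    apply: (ordS_invariant (i := i)) => [j lt_j|].
      have [+ _] := f_step j; have := f_ok (ordS j); rewrite /skipped; lia.
    by have := f_ok i; rewrite /skipped; lia.
  have : \sum_i #|window k c i :&: A| <= \sum_(i < #|V|) a.
    by apply: leq_sum => j _; have := below j; lia.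
  rewrite f_sum sum_nat_const card_ord; nia.
have above : forall j, a.+2 < #|window k c j :&: A|.
  apply: (ordS_invariant (i := i)) => [j lt_j|].
    have [_ +] := f_step j; have := f_ok (ordS j); rewrite /skipped; lia.
  by have := f_ok i; rewrite /skipped; lia.
have : \sum_(i < #|V|) a.+1 <= \sum_i #|window k c i :&: A|.
  by apply: leq_sum => j _; have := above j; lia.
rewrite f_sum sum_nat_const card_ord; nia.
Qed.

Lemma card_cycle_edgesI (E : {set {set V}}) :
  #|cycle_edges k c :&: E| = #|[set i | window k c i \in E]|.
Proof.
rewrite -(card_imset _ (window_inj lt_kn c_inj)); congr #|pred_of_set _|.
apply/setP => e; rewrite inE; apply/andP/imsetP => [[/imsetP[i _ ->] eE]|[i]].
  by exists i; rewrite ?inE.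
by rewrite inE => iE ->; split=> //; apply/imsetP; exists i.
Qed.

(** The windows contain [n * a] vertices of [A] plus one for each blue
    window, and [k * #|A| = n * a + n / 2] altogether. *)
Lemma skip_count_balanced :
  (2 * red_count skip_kgraph c = #|V| /\ 2 * blue_count skip_kgraph c = #|V|)%N.
Proof.
have [c_bij c_edge] := c_tight.
have red_or_blue i : (window k c i \in skip_red) = ~~ (window k c i \in skip_blue).
  by have := c_edge i; rewrite mem_skip_edges !inE ltnNge => /andP[-> ->]; rewrite negbK.
have red_blue : (red_count skip_kgraph c + blue_count skip_kgraph c = #|V|)%N.
  rewrite /red_count /blue_count !card_cycle_edgesI.
  rewrite -[RHS](card_ord #|V|) -(cardsC [set i | window k c i \in skip_red]).
  by congr addn; apply: eq_card => i; rewrite in_set in_setC in_set red_or_blue negbK.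
have f_val i : #|window k c i :&: A| = a + (window k c i \in skip_blue).
  have := c_edge i; rewrite mem_skip_edges [_ \in skip_blue]inE => /andP[-> ->] /=.
  by have := windowI_trapped i; case: ltnP; lia.
have : (k * #|A| = #|V| * a + blue_count skip_kgraph c)%N.
  rewrite -(sum_card_windowI A lekn c_bij) (eq_bigr _ (fun i _ => f_val i)) big_split /=.
  rewrite sum_nat_const [#|'I_ _|]card_ord /blue_count card_cycle_edgesI.
  rewrite -[#|[set _ | _]|]sum1_card; congr addn.
  by rewrite [RHS]big_mkcond; apply: eq_bigr => i _; rewrite inE; case: ifP.
nia.
Qed.
End Skip.

(** * Degrees *)

Section Degree.
Variable (V : finType).

(** A set [e] is determined by the pair [(e :&: A, e :\: A)], which here ranges
    over subsets of fixed sizes of [B :&: A] and [B :\: A]. *)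
Lemma card_draws_split (A B : {set V}) (r i : nat) :
  #|[set e : {set V} | [&& e \subset B, #|e| == r & #|e :&: A| == i]]|
    <= 'C(#|B :&: A|, i) * 'C(#|B :\: A|, r - i).
Proof.
rewrite -!cards_draws -cardsX.
set S := [set e | _]; pose split_by_A (e : {set V}) := (e :&: A, e :\: A).
have split_inj : injective split_by_A.
  by move=> e f [eqI eqD]; rewrite -(setID e A) eqI eqD setID.
rewrite -(card_imset (mem S) split_inj); apply/subset_leq_card/subsetP => _ /imsetP[e + ->].
rewrite !inE /= => /and3P[sub_eB /eqP <- /eqP <-].
by rewrite setSI // setSD // -(cardsID A e) addKn !eqxx.
Qed.

(** The vertex [v0] serves to bound the default value of the iterated minimum. *)
Lemma min_degree_ge k (H : coloured_kgraph k V) (v0 : V) d :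
  (forall v, d <= degree H v) -> d <= min_degree H.
Proof.
move=> d_le; rewrite /min_degree; elim/big_ind: _ => // [|x y dx dy].
  by apply: leq_trans (d_le v0) (subset_leq_card _); apply/subsetP => e; rewrite inE => /andP[].
by rewrite leq_min dx.
Qed.

(** Remove [v] from the [k]-sets that contain it: this leaves the [k - 1]-sets
    that avoid [v].  Those which do not complete to an edge are sorted by
    their number [i] of vertices in [A], to which [v] itself adds one when it
    lies in [A]. *)
Lemma skip_degree_ge k a (A : {set V}) (v : V) : 0 < k ->
  'C(#|V|.-1, k.-1) <= degree (skip_kgraph k a A) v +
    \sum_(i < k | skipped a (i + (v \in A)))
      'C(#|A :\ v|, i) * 'C(#|~: A :\ v|, k.-1 - i).
Proof.
move=> k_gt0.
pose link := [set e : {set V} | (e \subset ~: [set v]) && (#|e| == k.-1)].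
pose bad := [set e in link | skipped a (#|e :&: A| + (v \in A))].
have notin e : e \in link -> v \notin e.
  by rewrite inE => /andP[/subsetP sub _]; apply/negP => /sub; rewrite !inE eqxx.
have cardI e : e \in link -> #|(v |: e) :&: A| = #|e :&: A| + (v \in A).
  move=> /notin ve; rewrite setIUl cardsU addnC.
  have -> : [set v] :&: A :&: (e :&: A) = set0.
    apply/setP => x; rewrite !inE; case: eqP => //= ->; rewrite (negbTE ve) /=.
    by rewrite andbF.
  rewrite cards0 subn0; congr addn; case vA: (v \in A).
    by have /setIidPl -> : [set v] \subset A; rewrite ?cards1 ?sub1set.
  apply/eqP; rewrite cards_eq0 -subset0; apply/subsetP => x; rewrite !inE.
  by case: eqP => // -> /=; rewrite vA.
have card_link : #|link| = 'C(#|V|.-1, k.-1) by rewrite cards_draws cardsC1.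
have good_le : #|link :\: bad| <= degree (skip_kgraph k a A) v.
  rewrite -(@card_in_imset _ _ (fun e => v |: e)); last first.
    move=> e f /setDP[/notin ve _] /setDP[/notin vf _] /(congr1 (fun g => g :\ v)).
    by rewrite !setU1K.
  apply/subset_leq_card/subsetP => _ /imsetP[e /setDP[e_link e_good] ->].
  rewrite inE setU11 andbT mem_skip_edges cardI //.
  move: e_good; rewrite inE e_link /= => ->; rewrite andbT cardsU1 notin //.
  by move: e_link; rewrite inE => /andP[_ /eqP ->]; rewrite add1n prednK.
have /setIidPr bad_link : bad \subset link by apply/subsetP => e; rewrite inE => /andP[].
rewrite -card_link -(cardsID bad link) addnC leq_add // bad_link.
have lt_eA e : e \in link -> #|e :&: A| < k.
  rewrite inE => /andP[_ /eqP card_e]; rewrite -(prednK k_gt0) ltnS -card_e.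
  by rewrite subset_leq_card // subsetIl.
pose hits e : 'I_k := insubd (Ordinal k_gt0) #|e :&: A|.
have hitsE e : e \in link -> hits e = #|e :&: A| :> nat.
  by move=> /lt_eA lt; rewrite val_insubd lt.
rewrite -sum1_card (partition_big hits (fun i => skipped a (i + (v \in A)))) /=; last first.
  by move=> e; rewrite inE => /andP[e_link]; rewrite hitsE.
apply: leq_sum => i _; rewrite sum1_card !setDE [A :&: _]setIC [~: A :&: _]setIC -setDE.
apply: leq_trans (card_draws_split _ _ _ _); apply/subset_leq_card/subsetP => e.
case/andP=> e_bad /eqP <-; have /setIdP[e_link _] : e \in bad by [].
by move: (e_link); rewrite hitsE // !inE eqxx andbT.
Qed.
End Degree.

Local Open Scope ring_scope.

(** * The constants *)

(** The bound on [a] makes the parameter a probability; outside of [[0, 1]] the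
    binomial law takes a default value. *)
Lemma probX_pairE (R : realType) (k a i j : nat) : (a < k)%N -> i != j ->
  probX_pair R k a i%:Z j%:Z =
  binomial_pmf (k - 1) ((2 * a%:R + 1) / (2 * k%:R)) i +
  binomial_pmf (k - 1) ((2 * a%:R + 1) / (2 * k%:R)) j.
Proof.
move=> lt_ak neq_ij; rewrite /probX_pair /lawX /binomial_prob.
have k_gt0 : 0 < 2 * k%:R :> R by rewrite mulr_gt0 ?ltr0n //; lia.
set p := _ / _; have p01 : 0 <= p <= 1.
  have a_ge0 : 0 <= a%:R :> R by exact: ler0n.
  apply/andP; split; first by rewrite divr_ge0 // ?(ltW k_gt0) //; lra.
  rewrite ler_pdivrMr // mul1r.
  have : a%:R + 1 <= k%:R :> R by rewrite natr1 ler_nat.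
  by lra.
have -> : [set l : nat | l%:Z = i%:Z \/ l%:Z = j%:Z]%classic = [set i; j]%classic.
  apply/seteqP; split=> l /= [] => [[->]|[->]|->|->]; by [left|right].
rewrite p01 esum_fset //=; last by move=> l _; rewrite lee_fin binomial_pmf_ge0.
rewrite fsbigU0 // ?fsbig_set1 //.
by move=> l [/= -> eq_ij]; rewrite eq_ij eqxx in neq_ij.
Qed.

Lemma binomial_pmf_half (R : realType) (n i : nat) : (i <= n)%N ->
  binomial_pmf n (1 / 2 : R) i = 'C(n, i)%:R / 2 ^+ n.
Proof.
move=> le_in; rewrite /binomial_pmf /unstable.onem.
rewrite (_ : 1 - 1 / 2 = 1 / 2 :> R); last by field.
by rewrite -exprD subnKC // expr_div_n expr1n mul1r mulr_natl.
Qed.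

Lemma d_ka_17_8 (R : realType) : d_ka R 17 8 = 5761 / 8192.
Proof.
rewrite /d_ka (_ : 8%:Z - 1 = 7%:Z) // (_ : 8%:Z + 2 = 10%:Z) //.
rewrite (_ : 8%:Z - 2 = 6%:Z) // (_ : 8%:Z + 1 = 9%:Z) // !probX_pairE //.
rewrite (_ : (2 * 8 + 1) / (2 * 17) = 1 / 2 :> R); last by field.
rewrite !binomial_pmf_half // (@bin_sub 16 6) // (@bin_sub 16 7) //.
rewrite [X in Num.max _ X]addrC maxxx.
rewrite (_ : 'C(_, 7) = 11440%N) // (_ : 'C(_, 6) = 8008%N) //.
by field.
Qed.

Lemma d_k_17 (R : realType) : d_k R 17 = 1 - 8 / 17 * (33 / 34) ^+ 15.
Proof. by rewrite /d_k -[(17 - 2)%N]/15%N; field. Qed.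

(** * The density of the half-half hypergraph *)

(** Bernoulli's inequality, for a factor below 1. *)
Lemma ge1_expr_subr (R : realDomainType) (x : R) n :
  0 <= x <= 1 -> 1 - n%:R * x <= (1 - x) ^+ n.
Proof.
move=> x01; elim: n => [|n IHn]; first by rewrite mul0r subr0.
have n_ge0 : 0 <= n%:R :> R by [].
rewrite exprS; apply: le_trans (ler_wpM2l _ IHn); last by lra.
rewrite -natr1; nra.
Qed.

Lemma leq_exp_base m n r : (m <= n -> m ^ r <= n ^ r)%N.
Proof. by case: r => // r; rewrite leq_exp2r. Qed.

Lemma ffact_le_expn n r : (n ^_ r <= n ^ r)%N.
Proof.
elim: r n => // r IHr n; rewrite ffactnS expnS leq_mul2l; apply/orP; right.
exact: leq_trans (IHr _) (leq_exp_base _ (leq_pred _)).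
Qed.

Lemma expn_le_ffact n r : ((n - r.-1) ^ r <= n ^_ r)%N.
Proof.
elim: r n => // r IHr n; rewrite ffactnSr /= expnS mulnC leq_mul2r; apply/orP; right.
by apply: leq_trans (IHr _); rewrite leq_exp_base // leq_sub2l // leq_pred.
Qed.

Lemma expr_le_bin_fact (R : realDomainType) n r : (r.-1 <= n)%N ->
  (n%:R - r.-1%:R) ^+ r <= 'C(n, r)%:R * r`!%:R :> R.
Proof.
by move=> le_rn; rewrite -natrB // -natrX -natrM ler_nat bin_ffact expn_le_ffact.
Qed.

(** Since ['C(p, i) * i`! <= m ^ i], and likewise for [q] and [j], this follows
    from [(i + j)`! = 'C(i + j, i) * i`! * j`!].  The factorial stands on the left
    to avoid a division. *)
Lemma bin_mul_fact_le (R : realDomainType) m p q i j : (p <= m)%N -> (q <= m)%N ->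
  ('C(p, i) * 'C(q, j))%:R * (i + j)`!%:R <= 'C(i + j, i)%:R * m%:R ^+ (i + j) :> R.
Proof.
move=> le_pm le_qm; rewrite -natrX -!natrM ler_nat.
have bin_le r l : (r <= m)%N -> ('C(r, l) * l`! <= m ^ l)%N.
  by move=> le_rm; rewrite bin_ffact (leq_trans (ffact_le_expn _ _)) // leq_exp_base.
have := leq_mul (bin_le _ i le_pm) (bin_le _ j le_qm).
rewrite -expnD -(bin_fact (leq_addr j i)) addKn => /(leq_mul (leqnn 'C(i + j, i))).
by apply: leq_trans; nia.
Qed.

(** The relative error [15 / (2 * x)] is at most [75 / 10 ^ 6], and sixteen times
    that is the [12 / 10 ^ 4] lost here. *)
Lemma expr_sub15_ge (R : realFieldType) (x : R) : 10 ^+ 5 <= x ->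
  2 ^+ 16 * (1 - 12 / 10 ^+ 4) * x ^+ 16 <= (2 * x - 15) ^+ 16.
Proof.
move=> x_large; have x_gt0 : 0 < x by lra.
have -> : 2 * x - 15 = 2 * x * (1 - 15 / (2 * x)) by field; rewrite gt_eqF.
have y_small : 0 <= 15 / (2 * x) <= 75 / 10 ^+ 6.
  apply/andP; split; first by rewrite divr_ge0 //; lra.
  by rewrite ler_pdivrMr; lra.
rewrite exprMn (exprMn 16 2) [leLHS]mulrAC; apply: ler_wpM2l.
  by rewrite mulr_ge0 ?exprn_ge0 ?(ltW x_gt0).
by apply: le_trans (ge1_expr_subr _ _); lra.
Qed.

(** With [x = m], [B = C(2m, 16)], [B' = C(2m - 1, 16)] and [F = 16!], this is the
    comparison of densities.  The non-edges amount to
    [8 * 2431 = C(16, 6) + C(16, 9)] parts in [2 ^ 16] of [B], up to the error of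
    [expr_sub15_ge], and passing from [2m] to [2m - 1] costs the
    fraction [8 / x] of [B], at most [8 / 10 ^ 5].  The bound [639 / 1000] on the power, whose value is
    about 0.63904, is all that the linear arithmetic needs to know about
    [d_17]. *)
Lemma half_density_real (R : realFieldType) (x B B' bad F : R) :
  10 ^+ 5 <= x -> 0 < F -> 0 <= B -> 2 * x * B' = (2 * x - 16) * B ->
  (2 * x - 15) ^+ 16 <= B * F -> bad * F <= 8 * 2431 * x ^+ 16 ->
  (1 - 8 / 17 * (33 / 34) ^+ 15 + 1 / 1000) * B + bad <= B'.
Proof.
move=> x_large F_gt0 B_ge0 B'E /(le_trans (expr_sub15_ge x_large)).
move: (x ^+ 16) => P B_ge bad_le.
have : 639 / 1000 <= (33 / 34) ^+ 15 :> R by lra.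
move: (_ ^+ 15) => q q_ge.
have B'_ge : (1 - 8 / 10 ^+ 5) * B <= B'.
  have x2_gt0 : 0 < 2 * x by lra.
  rewrite -(ler_pM2l x2_gt0) B'E; nra.
apply: le_trans B'_ge; rewrite -(ler_pM2r F_gt0) mulrDl -!mulrA.
have BF_ge0 : 0 <= B * F by rewrite mulr_ge0 // ltW.
move: (B * F) (bad * F) BF_ge0 B_ge bad_le => T bF T_ge0 B_ge bad_le.
nra.
Qed.

Lemma half_density_bound (R : realType) m : (10 ^+ 5 <= m%:R :> R) ->
  (d_k R 17 + 1 / 1000) * 'C(2 * m, 16)%:R +
    ('C(m.-1, 6) * 'C(m, 10) + 'C(m.-1, 9) * 'C(m, 7))%:R
  <= 'C((2 * m).-1, 16)%:R :> R.
Proof.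
move=> m_large.
have m_ge8 : (8 <= m)%N by rewrite -(ler_nat R); lra.
rewrite d_k_17.
have F_gt0 : 0 < 16`!%:R :> R by rewrite ltr0n fact_gt0.
apply: (half_density_real m_large F_gt0 (ler0n _ _)).
- have /(congr1 (fun l => l%:R : R)) := mul_bin_down (2 * m) 16.
  by rewrite !natrM natrB ?natrM //; lia.
- by have := @expr_le_bin_fact R (2 * m) 16; rewrite natrM; apply; lia.
have C16 : 8 * 2431 = 'C(16, 6)%:R + 'C(16, 9)%:R :> R.
  by rewrite -natrM -natrD.
rewrite C16 natrD mulrDl [leRHS]mulrDl; apply: lerD.
  exact: bin_mul_fact_le 6 10 (leq_pred m) (leqnn m).
exact: bin_mul_fact_le 9 7 (leq_pred m) (leqnn m).
Qed.

(** * Half-half hypergraphs on 17-sets *)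

Definition half_set (m : nat) : {set bool * 'I_m} := setX [set true] setT.

Lemma card_half_set m : #|half_set m| = m.
Proof. by rewrite cardsX cards1 mul1n cardsT card_ord. Qed.

(** The hypergraph is regular: exchanging [A] with its complement maps the
    intersection sizes 7 and 10 to each other, so vertices on either side have
    the same non-edges up to this symmetry. *)
Lemma skip_min_degree_17_8 m : (0 < m)%N ->
  ('C((2 * m).-1, 16) <= min_degree (skip_kgraph 17 8 (half_set m)) +
    ('C(m.-1, 6) * 'C(m, 10) + 'C(m.-1, 9) * 'C(m, 7)))%N.
Proof.
move=> m_gt0; set bad := ('C(_, 6) * _ + _)%N; rewrite addnC -leq_subLR.
have cardV : #|{: bool * 'I_m}| = (2 * m)%N by rewrite card_prod card_bool card_ord.
apply: (min_degree_ge (true, Ordinal m_gt0)) => v.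
rewrite leq_subLR -cardV addnC.
apply: leq_trans (@skip_degree_ge _ 17 8 (half_set m) v isT) _.
rewrite leq_add2l.
have cardAv := cardsD1 v (half_set m).
have cardBv := cardsD1 v (~: half_set m).
have cardB := cardsC (half_set m).
rewrite cardV card_half_set in cardB; rewrite card_half_set in cardAv.
rewrite in_setC in cardBv.
move: #|half_set m :\ v| #|~: half_set m :\ v| #|~: half_set m| cardAv cardBv cardB.
(* The filter keeps two of the 17 indices: 6 and 9 for [v] in the half, 7 and 10
   for [v] outside it. *)
move=> x y z; rewrite -(big_mkord (fun i => skipped 8 (i + (v \in half_set m)))
  (fun i => 'C(x, i) * 'C(y, 16 - i))%N).
case: (v \in half_set m) => xE yE zE; rewrite unlock /= addn0 /bad.
  have -> : x = m.-1 by lia.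
  have -> : y = m by lia.
  by [].
have -> : x = m by lia.
have -> : y = m.-1 by lia.
by rewrite mulnC addnC mulnC.
Qed.

Lemma balanced_17_graphs (R : realType) (N : nat) :
  exists n : nat, (N <= n)%N /\
  exists (V : finType) (H : coloured_kgraph 17 V),
    [/\ #|V| = n,
        (d_k R 17 + 1 / 1000) * 'C(n, 16)%:R <= (min_degree H)%:R
      & forall c : 'I_#|V| -> V, tight_hamilton_cycle H c ->
          (red_count H c)%:R = n%:R / 2 :> R /\
          (blue_count H c)%:R = n%:R / 2 :> R].
Proof.
pose m := (N + 10 ^ 5)%N.
have m_large : 10 ^+ 5 <= m%:R :> R by rewrite natrD natrX lerDr.
have m_ge9 : (9 <= m)%N by rewrite -(ler_nat R); lra.
have le_Nm : (N <= m)%N by rewrite leq_addr.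
(* The value of [m] is forgotten, so that no step computes [10 ^ 5] in unary. *)
move: m m_large m_ge9 le_Nm => m m_large m_ge9 le_Nm.
have cardV : #|{: bool * 'I_m}| = (2 * m)%N by rewrite card_prod card_bool card_ord.
exists (2 * m)%N; split; first by lia.
exists (bool * 'I_m)%type, (skip_kgraph 17 8 (half_set m)); split=> //.
  have m_gt0 : (0 < m)%N by lia.
  have := skip_min_degree_17_8 m_gt0; rewrite -(ler_nat R) natrD.
  have := half_density_bound m_large.
  move=> density degree.
  rewrite -(lerD2r ('C(m.-1, 6) * 'C(m, 10) + 'C(m.-1, 9) * 'C(m, 7))%:R).
  exact: le_trans degree.
move=> c c_tight.
have [||red blue] := skip_count_balanced _ _ c_tight; rewrite ?card_half_set ?cardV; [lia|lia|].
have half l : (2 * l)%N = #|{: bool * 'I_m}| -> l%:R = (2 * m)%:R / 2 :> R.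
  by rewrite cardV => <-; rewrite natrM; field.
by split; apply: half.
Qed.

Theorem corollary1p3 (R : realType) :
  [/\ ~ (forall (k : nat) (alpha : R), (4 <= k)%N -> 0 < alpha ->
         exists delta : R, exists n0 : nat, 0 < delta /\
         forall (n : nat) (V : finType) (H : coloured_kgraph k V),
           (n0 <= n)%N -> #|V| = n ->
           (d_k R k + alpha) * 'C(n, k.-1)%:R <= (min_degree H)%:R ->
           exists c : 'I_#|V| -> V, tight_hamilton_cycle H c /\
             ((1 / 2 + delta) * n%:R <= (red_count H c)%:R \/
              (1 / 2 + delta) * n%:R <= (blue_count H c)%:R)),
      d_ka R 17 8 = 5761 / 8192,
      5761 / 8192 > 1 - 8 / 17 * (33 / 34) ^+ 15 :> R,
      1 - 8 / 17 * (33 / 34) ^+ 15 = d_k R 17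
    & exists alpha : R, 0 < alpha /\
      forall N : nat, exists n : nat, (N <= n)%N /\
      exists (V : finType) (H : coloured_kgraph 17 V),
        [/\ #|V| = n,
            (d_k R 17 + alpha) * 'C(n, 16)%:R <= (min_degree H)%:R
          & forall c : 'I_#|V| -> V, tight_hamilton_cycle H c ->
              (red_count H c)%:R = n%:R / 2 :> R /\
              (blue_count H c)%:R = n%:R / 2 :> R]].
Proof.
split; [|exact: d_ka_17_8|by lra|by rewrite d_k_17|].
  move=> /(_ 17 (1 / 1000) isT) []; first by lra.
  move=> delta [n0 [delta_gt0 unbalanced]].
  have [n [le_n0n [V [H [cardV degH balanced]]]]] := balanced_17_graphs R n0.+1.
  have [c [c_tight]] := unbalanced n V H (ltnW le_n0n) cardV degH.
  have [-> ->] := balanced c c_tight.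
  have n_gt0 : 0 < n%:R :> R by rewrite ltr0n (leq_ltn_trans _ le_n0n).
  by case; nra.
exists (1 / 1000); split; [by lra|exact: balanced_17_graphs].
Qed.
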